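(* Let $\mathbb{K}$ be $\mathbb{R}$ or $\mathbb{C}$, let $A\in\mathbb{K}^{m\times n}$, let $I$ be a finite list of row indices from $\{1,\dots,m\}$ and $J$ a finite list of column indices from $\{1,\dots,n\}$ (repeated entries are allowed in both). Let $C=A(:,J)$ and $R=A(I,:)$ be the corresponding column and row submatrices of $A$, and let $U=A(I,J)$ be their intersection. Then the following are equivalent: \begin{enumerate} \item[(i)] $\operatorname{rank}(U)=\operatorname{rank}(A)$; \item[(ii)] $A=CU^\dagger R$; \item[(iii)] $A=CC^\dagger A R^\dagger R$; \item[(iv)] $A^\dagger=R^\dagger U C^\dagger$; \item[(v)] $\operatorname{rank}(C)=\operatorname{rank}(R)=\operatorname{rank}(A)$. \end{enumerate} Moreover, if any of these equivalent conditions holds, then $U^\dagger=C^\dagger A R^\dagger$.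
   Context: For $I=(i_1,\dots,i_t)$ with $i_k\in\{1,\dots,m\}$ and $J=(j_1,\dots,j_s)$ with $j_\ell\in\{1,\dots,n\}$ (entries not necessarily distinct): $A(I,:)$ is the $t\times n$ matrix whose $k$-th row is row $i_k$ of $A$; $A(:,J)$ is the $m\times s$ matrix whose $\ell$-th column is column $j_\ell$ of $A$; and $A(I,J)$ is the $t\times s$ matrix with $(k,\ell)$ entry $A_{i_k,j_\ell}$. For a matrix $B\in\mathbb{K}^{p\times q}$, $B^\dagger\in\mathbb{K}^{q\times p}$ denotes its Moore--Penrose pseudoinverse, i.e. the unique matrix such that $BB^\dagger B=B$, $B^\dagger BB^\dagger=B^\dagger$, and both $BB^\dagger$ and $B^\dagger B$ are Hermitian. *)

(* Defs.v *)
From HB Require Import structures.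
From mathcomp Require Import all_boot all_order all_algebra.
From mathcomp Require Import sesquilinear reals complex.

Set Implicit Arguments.
Unset Strict Implicit.
Unset Printing Implicit Defensive.

Import Order.TTheory GRing.Theory Num.Theory.

Local Open Scope ring_scope.

Variant scalar_kind := RealScalars | ComplexScalars.

(* The base field is R or C, selected by [k]; [realType] characterizes the real
   numbers up to isomorphism. *)
Definition scalars (R : realType) (k : scalar_kind) : numFieldType :=
  match k with
  | RealScalars => R
  | ComplexScalars => R[i]%C
  end.

Definition scalar_conj (R : realType) (k : scalar_kind) :
    {rmorphism scalars R k -> scalars R k} :=
  match k return {rmorphism scalars R k -> scalars R k} with
  | RealScalars => idfun
  | ComplexScalars => @conjc R
  end.

Section MoorePenrose.
Variables (R : realType) (k : scalar_kind).
Local Notation K := (scalars R k).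
Local Notation conj := (@scalar_conj R k).
Local Notation "M ^t*" := (map_mx conj M^T) (at level 30).

(* [hermitianmx n false conj] is the predicate [M = map_mx conj M^T], i.e. the
   Hermitian matrices over C and the symmetric ones over R. *)
Definition is_pinv p q (B : 'M[K]_(p, q)) (X : 'M[K]_(q, p)) : bool :=
  [&& B *m X *m B == B,
      X *m B *m X == X,
      B *m X \is hermitianmx p false conj &
      X *m B \is hermitianmx q false conj].

Lemma scalar_conjK : involutive conj.
Proof. by rewrite /scalar_conj; case: k => // x; exact: conjcK. Qed.

Lemma scalar_normsq_ge0 (x : K) : 0 <= x * conj x.
Proof.
rewrite /scalar_conj; case: k x => x /=; first by rewrite -expr2 sqr_ge0.
case: x => a b; rewrite lecE /= !mulrN opprK (mulrC b) addNr eqxx /=.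
by rewrite -!expr2 addr_ge0 ?sqr_ge0.
Qed.

Lemma ctmxK p q (M : 'M[K]_(p, q)) : M ^t* ^t* = M.
Proof. by apply/matrixP=> i j; rewrite !mxE scalar_conjK. Qed.

Lemma ctmxM p q r (M : 'M[K]_(p, q)) (N : 'M[K]_(q, r)) :
  (M *m N) ^t* = N ^t* *m M ^t*.
Proof. by rewrite trmx_mul map_mxM. Qed.

Lemma hermP n (M : 'M[K]_n) :
  reflect (M ^t* = M) (M \is hermitianmx n false conj).
Proof.
apply: (iffP (is_hermitianmxP _ _ _)); by rewrite expr0 scale1r => /esym.
Qed.

Lemma mul_ctmx_eq0 p q (M : 'M[K]_(p, q)) : M *m M ^t* = 0 -> M = 0.
Proof.
move=> M0; apply/matrixP=> i j; rewrite [RHS]mxE.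
have /eqP : (M *m M ^t*) i i = 0 by rewrite M0 mxE.
rewrite mxE psumr_eq0 => [/allP/(_ j (mem_index_enum _))|l _]; last first.
  by rewrite !mxE scalar_normsq_ge0.
by rewrite /= !mxE mulf_eq0 fmorph_eq0 orbb => /eqP.
Qed.

Lemma unitmx_gram p q (M : 'M[K]_(p, q)) :
  row_free M -> M *m M ^t* \in unitmx.
Proof.
move=> fM; rewrite -row_free_unit -kermx_eq0; apply/eqP.
set x := kermx _; have x0 : x *m (M *m M ^t*) = 0 by exact: mulmx_ker.
apply: (row_free_inj fM); rewrite mul0mx; apply: mul_ctmx_eq0.
by rewrite ctmxM mulmxA -(mulmxA x) x0 mul0mx.
Qed.

Lemma pinv_exists_mul p q r (F : 'M[K]_(p, r)) (G : 'M[K]_(r, q)) :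
  row_full F -> row_free G -> exists X, is_pinv (F *m G) X.
Proof.
move=> fF fG; pose HG := G *m G ^t*; pose HF := F ^t* *m F.
have uG : HG \in unitmx by exact: unitmx_gram.
have uF : HF \in unitmx.
  rewrite /HF -{2}[F]ctmxK; apply: unitmx_gram.
  by rewrite /row_free mxrank_map mxrank_tr.
have hG : HG ^t* = HG by rewrite ctmxM ctmxK.
have hF : HF ^t* = HF by rewrite ctmxM ctmxK.
have hiG : (invmx HG) ^t* = invmx HG by rewrite trmx_inv map_invmx hG.
have hiF : (invmx HF) ^t* = invmx HF by rewrite trmx_inv map_invmx hF.
pose X := G ^t* *m invmx HG *m invmx HF *m F ^t*.
have BX : F *m G *m X = F *m invmx HF *m F ^t*.
  by rewrite /X !mulmxA -(mulmxA F) -/HG -(mulmxA F HG) mulmxV // mulmx1.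
have XB : X *m (F *m G) = G ^t* *m invmx HG *m G.
  by rewrite /X !mulmxA -(mulmxA _ _ F) -/HF -(mulmxA _ _ HF) mulVmx // mulmx1.
exists X; apply/and4P; split.
- rewrite BX !mulmxA -(mulmxA _ _ F) -/HF -(mulmxA _ _ HF) mulVmx //.
  by rewrite mulmx1.
- rewrite XB /X !mulmxA -(mulmxA _ G) -/HG.
  by rewrite -(mulmxA _ _ HG) mulVmx // mulmx1.
- by apply/hermP; rewrite BX !ctmxM ctmxK hiF mulmxA.
- by apply/hermP; rewrite XB !ctmxM ctmxK hiG mulmxA.
Qed.

Lemma pinv_exists p q (B : 'M[K]_(p, q)) : exists X, is_pinv B X.
Proof.
rewrite -(mulmx_base B).
by apply: pinv_exists_mul; [exact: col_base_full | exact: row_base_free].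
Qed.

Lemma is_pinv_uniq p q (B : 'M[K]_(p, q)) X Y :
  is_pinv B X -> is_pinv B Y -> X = Y.
Proof.
case/and4P=> /eqP X1 /eqP X2 /hermP X3 /hermP X4.
case/and4P=> /eqP Y1 /eqP Y2 /hermP Y3 /hermP Y4.
have e1 : B *m X = B *m Y.
  rewrite -X3 -{1}Y1 -(mulmxA _ B X) ctmxM X3 Y3 mulmxA.
  by rewrite X1.
have e2 : X *m B = Y *m B.
  rewrite -X4 -{1}Y1 -(mulmxA B) mulmxA ctmxM X4 Y4.
  by rewrite -mulmxA (mulmxA B) X1.
by rewrite -X2 e2 -mulmxA e1 mulmxA Y2.
Qed.

(* [xchoose] does not depend on the existence proof; by [pinvP] and
   [is_pinv_uniq] it picks the unique solution of the Penrose equations. *)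
Definition pinv p q (B : 'M[K]_(p, q)) : 'M[K]_(q, p) :=
  xchoose (pinv_exists B).

Lemma pinvP p q (B : 'M[K]_(p, q)) : is_pinv B (pinv B).
Proof. exact: xchooseP. Qed.

End MoorePenrose.

Notation "B ^†" := (pinv B) (at level 2, left associativity, format "B ^†")
  : ring_scope.

(* Main.v *)
Require Import Defs.
From mathcomp Require Import all_boot all_order all_algebra.
From mathcomp Require Import reals.

(** Write [C = A P], [R = Q A] and [U = Q A P], where [P] and [Q] are the 0/1
    matrices that select the columns [J] and the rows [I].  The
    argument rests on these three factorizations and covers arbitrary [P], [Q].

    Each of the five conditions amounts to saying that [C] has the same column
    space as [A] and [R] the same row space as [A], that is, [A = C Z = W R]
    for some [Z] and [W].  Substituting one factorization into the other
    gives [C = W U],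
    [R = U Z] and [A = W U Z], from which the rank of [U] and the identity
    [A = C U^† R] can be read off.  In the other direction, the rank conditions
    force such [Z] and [W] to exist, the two product formulas for [A] display
    them, and the formula for [A^†] bounds the rank of [A] by those of [C] and
    [R].

    The statements on pseudoinverses rest on the fact that [B B^†] and [B^† B]
    are the orthogonal projections attached to the column space and to the row
    space of [B].  Equality of spaces therefore gives [C C^† = A A^†]
    ([pinv_colproj]) and [R^† R = A^† A] ([pinv_rowproj]).  Moreover
    [U = Q A P = Q A A^† A P = R A^† C] always ([cross_pinv]); multiplying by
    [R^†] and [C^†] turns both outer factors into the projections of [A],
    whence [R^† U C^† = A^†].  The formula for [U^†] comes by checking the four
    Penrose equations on [C^† A R^†]. *)

Set Implicit Arguments.
Unset Strict Implicit.
Unset Printing Implicit Defensive.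

Import GRing.Theory.

Local Open Scope ring_scope.

(** * Orthogonal projections from the pseudoinverse *)

Section Projections.
Context {F : realType} {k : scalar_kind}.
Local Notation K := (scalars F k).
Local Notation conj := (@scalar_conj F k).
Implicit Types p q r : nat.

Lemma mul_pinvK p q (B : 'M[K]_(p, q)) : B *m B^† *m B = B.
Proof. by case/and4P: (pinvP B) => /eqP. Qed.

Lemma pinv_mulK p q (B : 'M[K]_(p, q)) : B^† *m B *m B^† = B^†.
Proof. by case/and4P: (pinvP B) => _ /eqP. Qed.

Lemma mul_pinv_herm p q (B : 'M[K]_(p, q)) :
  B *m B^† \is hermitianmx p false conj.
Proof. by case/and4P: (pinvP B). Qed.

Lemma pinv_mul_herm p q (B : 'M[K]_(p, q)) :
  B^† *m B \is hermitianmx q false conj.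
Proof. by case/and4P: (pinvP B). Qed.

Lemma mulmx_pinv_inner m n p q (W : 'M[K]_(m, p)) (B : 'M_(p, q))
    (Z : 'M_(q, n)) :
  W *m B *m B^† *m (B *m Z) = W *m B *m Z.
Proof. by rewrite mulmxA -(mulmxA W B B^†) -(mulmxA W _ B) mul_pinvK. Qed.

(** [C C^†] and [R^† R] fix [C] and [R] respectively. *)
Lemma cur_proj m n s t (A : 'M[K]_(m, n)) (C : 'M_(m, s)) (X : 'M_(s, t))
    (R : 'M_(t, n)) :
  A = C *m X *m R -> A = C *m C^† *m A *m R^† *m R.
Proof.
move=> ->; rewrite !mulmxA mul_pinvK.
by rewrite -(mulmxA _ R R^†) -(mulmxA (C *m X)) mul_pinvK.
Qed.

Lemma mxrank_pinv p q (B : 'M[K]_(p, q)) : \rank B^† = \rank B.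
Proof.
apply/eqP; rewrite eqn_leq; apply/andP; split.
  by rewrite -{1}(pinv_mulK B) (leq_trans (mxrankM_maxl _ _)) ?mxrankM_maxr.
by rewrite -{1}(mul_pinvK B) (leq_trans (mxrankM_maxl _ _)) ?mxrankM_maxr.
Qed.

(** If [M N = N] and [N M = M], then [M = M^* = (N M)^* = M N = N]. *)
Lemma herm_eq_mull p (M N : 'M[K]_p) :
    M \is hermitianmx p false conj -> N \is hermitianmx p false conj ->
  M *m N = N -> N *m M = M -> M = N.
Proof.
move=> /hermP hM /hermP hN MN NM.
by rewrite -hM -NM ctmxM hM hN.
Qed.

Lemma herm_eq_mulr p (M N : 'M[K]_p) :
    M \is hermitianmx p false conj -> N \is hermitianmx p false conj ->
  M *m N = M -> N *m M = N -> M = N.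
Proof.
move=> /hermP hM /hermP hN MN NM.
by rewrite -hM -MN ctmxM hM hN.
Qed.

(** The hypotheses say that [B] and [C] have the same column space; each of
    the two projections then fixes the range of the other. *)
Lemma pinv_colproj p q r (B : 'M[K]_(p, q)) (C : 'M[K]_(p, r)) X Z :
  C = B *m X -> B = C *m Z -> C *m C^† = B *m B^†.
Proof.
move=> CX BZ.
have fixB : C *m C^† *m B = B by rewrite [in LHS]BZ mulmxA mul_pinvK -BZ.
have fixC : B *m B^† *m C = C by rewrite [in LHS]CX mulmxA mul_pinvK -CX.
by apply: herm_eq_mull; rewrite ?mul_pinv_herm // mulmxA (fixB, fixC).
Qed.

(** The row-space counterpart of [pinv_colproj]: here the projections act on
    the right, so they absorb each other on the opposite side. *)
Lemma pinv_rowproj p q r (B : 'M[K]_(p, q)) (R : 'M[K]_(r, q)) Y W :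
  R = Y *m B -> B = W *m R -> R^† *m R = B^† *m B.
Proof.
move=> RY BW.
have fixB : B *m (R^† *m R) = B.
  by rewrite [in LHS]BW -mulmxA (mulmxA R) mul_pinvK -BW.
have fixR : R *m (B^† *m B) = R.
  by rewrite [in LHS]RY -mulmxA (mulmxA B) mul_pinvK -RY.
by apply: herm_eq_mulr; rewrite ?pinv_mul_herm // -mulmxA (fixB, fixR).
Qed.

End Projections.

(** * Factorizations forced by rank equalities *)

Section Factorizations.
Context {F : fieldType}.

Lemma rank_row_factor m n t (A : 'M[F]_(m, n)) (Q : 'M_(t, m)) :
  \rank (Q *m A) = \rank A -> exists W, A = W *m (Q *m A).
Proof.
move=> rk; apply/submxP.
by rewrite -(mxrank_leqif_sup (submxMl Q A)) rk.
Qed.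

Lemma rank_col_factor m n s (A : 'M[F]_(m, n)) (P : 'M_(n, s)) :
  \rank (A *m P) = \rank A -> exists Z, A = A *m P *m Z.
Proof.
rewrite -mxrank_tr trmx_mul -(mxrank_tr A) => /rank_row_factor[W eqA].
by exists W^T; apply: trmx_inj; rewrite !trmx_mul trmxK.
Qed.

Lemma mxrank_mul_sandwich m n p q (X : 'M[F]_(m, p)) (Y : 'M_(p, q))
    (Z : 'M_(q, n)) :
  (\rank (X *m Y *m Z) <= \rank Y)%N.
Proof. exact: leq_trans (mxrankM_maxl _ _) (mxrankM_maxr _ _). Qed.

End Factorizations.

(** * The equivalence for arbitrary left and right factors *)

Section CUR.
Context {F : realType} {k : scalar_kind} {m n t s : nat}.
Local Notation K := (scalars F k).
Context {A : 'M[K]_(m, n)} {P : 'M[K]_(n, s)} {Q : 'M[K]_(t, m)}.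
Local Notation C := (A *m P).
Local Notation R := (Q *m A).
Local Notation U := (Q *m A *m P).

(** The common content of all the conditions, as explicit factorizations
    rather than equality of row and column spaces: [Z] and [W] are what the
    computations below substitute. *)
Definition spanning := (exists Z, A = C *m Z) /\ (exists W, A = W *m R).

Lemma cross_pinv : U = R *m A^† *m C.
Proof. by rewrite !mulmxA -(mulmxA Q A A^†) -(mulmxA Q _ A) mul_pinvK. Qed.

(** The ranks of [C] and [R] lie between those of [U] and [A]. *)
Lemma mxrank_cross_eq : \rank U = \rank A ->
  \rank C = \rank R /\ \rank R = \rank A.
Proof.
move=> rkU; have leU : (\rank U <= \rank C)%N by rewrite -mulmxA mxrankM_maxr.
have leUR : (\rank U <= \rank R)%N by exact: mxrankM_maxl.
have eqC : \rank C = \rank A by apply/eqP; rewrite eqn_leq mxrankM_maxl -rkU.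
have eqR : \rank R = \rank A by apply/eqP; rewrite eqn_leq mxrankM_maxr -rkU.
by rewrite eqC eqR.
Qed.

Lemma mxrank_spanning :
  \rank C = \rank R /\ \rank R = \rank A -> spanning.
Proof.
case=> rkCR rkR; split; first by apply: rank_col_factor; rewrite rkCR.
exact: rank_row_factor.
Qed.

(** [A = W U Z] bounds the rank of [A] by that of [U]. *)
Lemma spanning_mxrank_cross : spanning -> \rank U = \rank A.
Proof.
case=> [[Z AZ] [W AW]]; apply/eqP; rewrite eqn_leq.
rewrite (leq_trans (mxrankM_maxl _ _) (mxrankM_maxr _ _)) /=.
have {1}-> : A = W *m U *m Z by rewrite mulmxA -AW.
exact: mxrank_mul_sandwich.
Qed.

(** With [A = W U Z], [C = W U] and [R = U Z], this is [U U^† U = U]. *)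
Lemma spanning_cur : spanning -> A = C *m U^† *m R.
Proof.
case=> [[Z AZ] [W AW]].
have CW : C = W *m U by rewrite mulmxA -AW.
have RZ : R = U *m Z by rewrite -(mulmxA Q) -mulmxA -AZ.
have -> : C *m U^† *m R = W *m U *m U^† *m (U *m Z) by rewrite -CW -RZ.
by rewrite mulmx_pinv_inner -CW -AZ.
Qed.

Lemma proj_spanning : A = C *m C^† *m A *m R^† *m R -> spanning.
Proof.
move=> Aproj; split.
  by exists (C^† *m A *m R^† *m R); rewrite {1}Aproj !mulmxA.
by exists (C *m C^† *m A *m R^†).
Qed.

Lemma spanning_colproj : spanning -> C *m C^† = A *m A^†.
Proof. by case=> [[Z AZ] _]; apply: pinv_colproj AZ. Qed.

Lemma spanning_rowproj : spanning -> R^† *m R = A^† *m A.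
Proof. by case=> [_ [W AW]]; apply: pinv_rowproj AW. Qed.

Lemma spanning_pinv : spanning -> A^† = R^† *m U *m C^†.
Proof.
move=> span; rewrite cross_pinv !mulmxA -(mulmxA R^†) spanning_rowproj //.
rewrite pinv_mulK -!mulmxA (mulmxA A) spanning_colproj //.
by rewrite mulmxA pinv_mulK.
Qed.

(** [\rank A = \rank A^†] is bounded by the ranks of [C^†] and of [R^†]. *)
Lemma pinv_mxrank : A^† = R^† *m U *m C^† ->
  \rank C = \rank R /\ \rank R = \rank A.
Proof.
move=> Apinv.
have leC : (\rank A <= \rank C)%N.
  by rewrite -mxrank_pinv -[X in (_ <= X)%N]mxrank_pinv Apinv mxrankM_maxr.
have leR : (\rank A <= \rank R)%N.
  rewrite -mxrank_pinv -[X in (_ <= X)%N]mxrank_pinv Apinv -mulmxA.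
  exact: mxrankM_maxl.
have eqC : \rank C = \rank A by apply/eqP; rewrite eqn_leq mxrankM_maxl.
have eqR : \rank R = \rank A by apply/eqP; rewrite eqn_leq mxrankM_maxr.
by rewrite eqC eqR.
Qed.

(** With [X = C^† A R^†] and [U = R A^† C], the products [U X] and [X U]
    collapse to the projections [R R^†] and [C^† C], so the four Penrose
    equations for [U] are inherited from those for [R] and [C]. *)
Lemma spanning_cross_pinv : spanning -> U^† = C^† *m A *m R^†.
Proof.
move=> span; set X := C^† *m A *m R^†.
have colC := spanning_colproj span; have rowR := spanning_rowproj span.
have UX : U *m X = R *m R^†.
  have -> : U *m X = R *m (A^† *m (C *m C^†) *m A) *m R^†.
    by rewrite cross_pinv !mulmxA.
  by rewrite colC (mulmxA A^†) pinv_mulK -rowR (mulmxA R R^†) mul_pinvK.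
have XU : X *m U = C^† *m C.
  have -> : X *m U = C^† *m (A *m (R^† *m R) *m A^† *m C).
    by rewrite cross_pinv !mulmxA.
  by rewrite rowR (mulmxA A) mul_pinvK -colC mul_pinvK.
apply: (is_pinv_uniq (pinvP U)); apply/and4P; split.
- by rewrite UX cross_pinv (mulmxA (R *m _)) (mulmxA _ R) mul_pinvK.
- by rewrite XU (mulmxA (C^† *m C)) (mulmxA (C^† *m C)) pinv_mulK.
- by rewrite UX mul_pinv_herm.
- by rewrite XU pinv_mul_herm.
Qed.

End CUR.

Theorem theorem1 (F : realType) (k : scalar_kind) (m n t s : nat)
    (A : 'M[scalars F k]_(m, n)) (I : t.-tuple 'I_m) (J : s.-tuple 'I_n) :
  let C : 'M[scalars F k]_(m, s) := colsub (tnth J) A in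
  let R : 'M[scalars F k]_(t, n) := rowsub (tnth I) A in
  let U : 'M[scalars F k]_(t, s) := mxsub (tnth I) (tnth J) A in
  [<-> \rank U = \rank A;
       A = C *m U^† *m R;
       A = C *m C^† *m A *m R^† *m R;
       A^† = R^† *m U *m C^†;
       \rank C = \rank R /\ \rank R = \rank A] /\
  (\rank U = \rank A \/
   A = C *m U^† *m R \/
   A = C *m C^† *m A *m R^† *m R \/
   A^† = R^† *m U *m C^† \/
   (\rank C = \rank R /\ \rank R = \rank A) ->
   U^† = C^† *m A *m R^†).
Proof.
move=> C R U.
(* The selection matrices are the submatrices of the identity with the rows
   listed in [I], respectively the columns listed in [J]. *)
have CE : C = A *m colsub (tnth J) 1%:M by rewrite mulmx_colsub mulmx1.
have RE : R = rowsub (tnth I) 1%:M *m A by rewrite mul_rowsub_mx mul1mx.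
have UE : U = rowsub (tnth I) 1%:M *m A *m colsub (tnth J) 1%:M.
  by rewrite -RE mulmx_colsub mulmx1; apply/matrixP => i j; rewrite !mxE.
rewrite {}CE {}RE {}UE; split.
  tfae.
  - by move=> /mxrank_cross_eq/mxrank_spanning/spanning_cur.
  - exact: cur_proj.
  - by move=> /proj_spanning/spanning_pinv.
  - exact: pinv_mxrank.
  - by move=> /mxrank_spanning/spanning_mxrank_cross.
move=> conds; apply: spanning_cross_pinv.
case: conds => [|[|[|[]]]].
- by move=> /mxrank_cross_eq/mxrank_spanning.
- by move=> /cur_proj/proj_spanning.
- exact: proj_spanning.
- by move=> /pinv_mxrank/mxrank_spanning.
- exact: mxrank_spanning.
Qed.
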